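(* Let $n$ be a positive integer and let $R$ be a recovering set of the Boolean lattice $B_n$. Then $|R| \le \sqrt{3}\cdot 2^{0.4392\,n}$.
   Context: The Boolean lattice $B_n$ is the lattice of all subsets of $\{1,\ldots,n\}$ ordered by inclusion, so that $a\wedge b = a\cap b$ and $a\vee b = a\cup b$. A recovering set of a lattice $L$ is a subset $R$ of the points of $L$ such that for any four different points $a_1,a_2,a_3,a_4\in R$ we have all of the following: $a_1\wedge a_2\neq a_3\wedge a_4$, $a_1\vee a_2\neq a_3\vee a_4$, $a_1\wedge a_2\neq a_1\wedge a_3$, and $a_1\vee a_2\neq a_1\vee a_3$. *)

(* Defs.v *)
From HB Require Import structures.
From mathcomp Require Import all_boot all_order all_algebra.
From mathcomp Require Import all_reals exp.

Set Implicit Arguments.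
Unset Strict Implicit.
Unset Printing Implicit Defensive.

Import Order.TTheory GRing.Theory Num.Theory.

(* Orders [{set T}] canonically by inclusion, so that [{set 'I_n}] is the
   Boolean lattice B_n, with the ground set {1, ..., n} indexed from 0. *)
Export Order.DefaultSetSubsetOrder.

Local Open Scope order_scope.

Definition recovering d (L : latticeType d) (R : {pred L}) : Prop :=
  forall a1 a2 a3 a4 : L,
    a1 \in R -> a2 \in R -> a3 \in R -> a4 \in R ->
    uniq [:: a1; a2; a3; a4] ->
    [/\ a1 `&` a2 <> a3 `&` a4,
        a1 `|` a2 <> a3 `|` a4,
        a1 `&` a2 <> a1 `&` a3 &
        a1 `|` a2 <> a1 `|` a3].

Lemma meet_setE (T : finType) (A B : {set T}) : A `&` B = A :&: B.
Proof. by []. Qed.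

Lemma join_setE (T : finType) (A B : {set T}) : A `|` B = A :|: B.
Proof. by []. Qed.

Lemma le_setE (T : finType) (A B : {set T}) : (A <= B) = (A \subset B).
Proof. by []. Qed.

(* Main.v *)
Require Import Defs.
From HB Require Import structures.
From mathcomp Require Import all_boot all_order all_algebra.
From mathcomp Require Import all_reals exp.
From mathcomp Require Import ring lra zify.

(** Write N for the size of R and P = 'C(N, 2).  Once N > 3, recovering says
    exactly enough to make the meets of the P two-element subsets of R pairwise
    distinct, and likewise their joins: two pairs that share a point are
    separated with the help of any fourth point.  So the meets form a family of
    P subsets of the ground set, and so do the complements of the joins.

    The entropy of a uniformly chosen member of a set family is at most the sum
    of its coordinate entropies ([family_entropy_le]).  If k members of R
    contain the point i and m = N - k do not, then i lies in 'C(k, 2) of the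
    meets and outside 'C(m, 2) of the joins.  The two bounds add up to
    2 ln P <= the sum over i of two binary entropies, of parameters close to
    p^2 and (1 - p)^2 with p = k / N.  These cannot both be near their maximum
    ln 2: their sum is at most 1.7568 ln 2 ([cost_le]), whence
    P <= 2 ^ (0.8784 n).

    Finally N^2 <= 3 P as soon as N >= 3, and this is where the factor sqrt 3
    comes from.  For N <= 3 the recovering condition may be void, and the bound
    only reflects that R lives in a lattice with 2 ^ n points. *)

Set Implicit Arguments.
Unset Strict Implicit.
Unset Printing Implicit Defensive.

Import Order.TTheory GRing.Theory Num.Theory.
Local Open Scope ring_scope.

(** * Entropy bound for set families *)

Section Entropy.
Variables (K : realType) (T : finType).

(** Subadditivity of entropy in Gibbs' form: each coordinate entropy is replaced
    by the cross-entropy against a freely chosen Bernoulli parameter [t i], so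
    that rational parameters suffice later.  The product measure q of these
    Bernoulli laws has total mass 1, hence mass at most 1 on the family; summing
    ln x <= x - 1 at x = #|F| q(A) over the members A gives the bound. *)
Lemma family_entropy_le (F : {set {set T}}) (t : T -> K) :
    (forall i, 0 < t i < 1) ->
  #|F|%:R * ln #|F|%:R <=
    \sum_i - (#|[set A in F | i \in A]|%:R * ln (t i)
              + (#|F|%:R - #|[set A in F | i \in A]|%:R) * ln (1 - t i)).
Proof.
move=> t01.
have [->|F0] := eqVneq F set0.
  rewrite cards0 mul0r sumr_ge0 // => i _.
  rewrite (_ : [set A in _ | _] = set0) ?cards0 ?subrr ?mul0r ?addr0 ?oppr0 //.
  by apply/setP=> A; rewrite !inE.
have N0 : 0 < #|F|%:R :> K by rewrite ltr0n card_gt0.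
pose w (A : {set T}) i := if i \in A then t i else 1 - t i.
pose q A := \prod_i w A i.
have w0 A i : 0 < w A i.
  by rewrite /w; have /andP[? ?] := t01 i; case: ifP => // _; lra.
have q0 A : 0 < q A by rewrite prodr_gt0.
have q1 : \sum_A q A = 1.
  rewrite -(bigA_distr _ _ t (fun i => 1 - t i)) big1 // => i _ /=.
  by rewrite addrC subrK.
have qF : \sum_(A in F) q A <= 1.
  rewrite -q1 [leRHS](bigID (mem F)) /= lerDl sumr_ge0 // => A _.
  exact: ltW.
have lnq A : ln (q A) = \sum_i ln (w A i).
  rewrite /q; apply: (big_rec2 (fun x y => 0 < x /\ ln x = y)
    (P := xpredT) (F1 := w A) (F2 := fun i => ln (w A i)) _ _).2.
    by rewrite ln1.
  move=> i x y _ [x0 <-]; split; first by rewrite mulr_gt0.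
  by rewrite lnM // posrE.
have lnqF : \sum_(A in F) ln (q A) =
    \sum_i (#|[set A in F | i \in A]|%:R * ln (t i)
              + (#|F|%:R - #|[set A in F | i \in A]|%:R) * ln (1 - t i)).
  under eq_bigr do rewrite lnq.
  rewrite exchange_big /=; apply: eq_bigr => i _.
  rewrite (bigID (fun A : {set T} => i \in A)) /=.
  rewrite (eq_bigr (fun=> ln (t i))); last by move=> A /andP[_ iA]; rewrite /w iA.
  rewrite [X in _ + X](eq_bigr (fun=> ln (1 - t i))); last first.
    by move=> A /andP[_ iA]; rewrite /w (negPf iA).
  rewrite !sumr_const -[ln (t i) *+ _]mulr_natl -[ln (1 - t i) *+ _]mulr_natl.
  have card_split : #|F| = (#|[set A in F | i \in A]| + #|[set A in F | i \notin A]|)%N.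
    rewrite -(cardsID [set A : {set T} | i \in A] F); congr (_ + _)%N.
      by apply: eq_card => A; rewrite !inE.
    by apply: eq_card => A; rewrite !inE andbC.
  rewrite card_split natrD addrAC subrr add0r.
  by congr (_%:R * _ + _%:R * _); apply: eq_card => A; rewrite !inE.
rewrite sumrN -lnqF -subr_le0 opprK.
apply: (@le_trans _ _ (\sum_(A in F) (#|F|%:R * q A - 1))).
  rewrite mulr_natl -sumr_const -big_split /=; apply: ler_sum => A _.
  rewrite -lnM ?posrE // -[X in ln X](subrK 1) addrC.
  by apply: le_ln1Dx; rewrite ltrBrDr addrC subrr mulr_gt0.
rewrite sumrB sumr_const -mulr_sumr -[1 *+ _]/(#|F|%:R) subr_le0.
by rewrite ger_pMr.
Qed.

End Entropy.

(** * Pairs of points and their meets *)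

Definition pairs (L : finType) (R : {set L}) : {set {set L}} :=
  [set e : {set L} | e \subset R & #|e| == 2].

Lemma card_pairs (L : finType) (R : {set L}) : #|pairs R| = 'C(#|R|, 2).
Proof. exact: cards_draws. Qed.

(** For [f] the meet or the join, the hypothesis is what recovering provides.
    It mentions four points even when it compares the pairs {a, b} and {a, c},
    which is why the set must have a fourth element to serve as [d]. *)
Lemma pairs_inj (L V : finType) (R : {set L}) (f : {set L} -> V) :
    (3 < #|R|)%N ->
    (forall a b c d, a \in R -> b \in R -> c \in R -> d \in R ->
       uniq [:: a; b; c; d] ->
       f [set a; b] <> f [set c; d] /\ f [set a; b] <> f [set a; c]) ->
  {in pairs R &, injective f}.
Proof.
move=> R3 fR.
have share a b c : a \in R -> b \in R -> c \in R -> a != b -> a != c -> b != c ->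
    f [set a; b] <> f [set a; c].
  move=> aR bR cR ab ac bc.
  have /subsetPn[d dR] : ~~ (R \subset [set a; b; c]).
    apply: contraL R3 => /subset_leq_card /leq_trans; rewrite -leqNgt; apply.
    by rewrite setUC cardsU1 cards2; case: (_ \notin _); case: (a != b).
  rewrite !inE !negb_or => /andP[/andP[da db] dc].
  apply: (fR a b c d _ _ _ _ _).2 => //=.
  by rewrite !inE !negb_or ab ac bc ![_ == d]eq_sym da db dc.
move=> e1 e2; rewrite !inE => /andP[s1 /cards2P[a [b [ab e1E]]]].
move=> /andP[s2 /cards2P[c [d [cd e2E]]]]; subst e1 e2.
move: s1 s2; rewrite !subUset !sub1set => /andP[aR bR] /andP[cR dR] fE.
have [ac|ac] := eqVneq a c.
  subst c; have [->//|bd] := eqVneq b d.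
  by case: (share a b d).
have [ad|ad] := eqVneq a d.
  subst d; have [->|bc] := eqVneq b c; first by rewrite setUC.
  by case: (share a b c) => //; rewrite fE setUC.
have [bc|bc] := eqVneq b c.
  subst c; case: (share b a d) => //; first by rewrite eq_sym.
  by rewrite setUC.
have [bd|bd] := eqVneq b d.
  subst d; case: (share b a c) => //; first by rewrite eq_sym.
  by rewrite setUC fE setUC.
case: (fR a b c d aR bR cR dR) => //=.
by rewrite !inE !negb_or ab ac ad bc bd cd.
Qed.

(** A point belongs to the meet of a pair exactly when both members contain it,
    that is, when the pair is drawn from the set [S] of members containing it;
    so coordinate degrees of the family of meets are binomial coefficients. *)
Lemma card_pairs_image (L T : finType) (R S : {set L})
    (f : {set L} -> {set T}) i :
    {in pairs R &, injective f} -> S \subset R ->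
    {in pairs R, forall e, (i \in f e) = (e \subset S)} ->
  #|[set A in f @: pairs R | i \in A]| = 'C(#|S|, 2).
Proof.
move=> finj sSR fE; rewrite -card_pairs.
have sub e : e \in pairs S -> e \in pairs R.
  by rewrite !inE => /andP[/subset_trans-> //].
rewrite -(card_in_imset (f := f) (D := mem (pairs S))); last first.
  by move=> e1 e2 /sub e1R /sub e2R; apply: finj.
apply: eq_card => A; rewrite inE; apply/andP/imsetP.
  case=> /imsetP[e eR ->]; rewrite fE // => eS; exists e => //.
  by rewrite inE eS; move: eR; rewrite inE => /andP[].
case=> e eS ->; rewrite imset_f ?sub // fE ?sub //.
by split=> //; move: eS; rewrite inE => /andP[].
Qed.

(** * Cost of one coordinate *)

Section Cost.
Variable K : realType.

Lemma natr_bin2 k : 'C(k, 2)%:R = k%:R * (k%:R - 1) / 2 :> K.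
Proof.
elim: k => [|k IH]; first by rewrite bin0n !mul0r.
by rewrite binS bin1 natrD IH -natr1; field.
Qed.

Lemma ln2_gt0 : 0 < ln 2 :> K.
Proof. by rewrite ln_gt0 // ltr1n. Qed.

(** That is, 2 ^ 11 <= 3 ^ 7. *)
Lemma ln2_ln3 : 11 * ln 2 <= 7 * ln 3 :> K.
Proof.
rewrite !mulr_natl -!lnXn ?ltr0n // ler_ln ?posrE ?exprn_gt0 ?ltr0n //.
by rewrite -!natrX ler_nat.
Qed.

(** That is, 3 ^ 4 <= 2 ^ 7. *)
Lemma ln3_ln2 : 4 * ln 3 <= 7 * ln 2 :> K.
Proof.
rewrite !mulr_natl -!lnXn ?ltr0n // ler_ln ?posrE ?exprn_gt0 ?ltr0n //.
by rewrite -!natrX ler_nat.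
Qed.

(** Bernoulli parameter for a coordinate that lies in [k] members and misses [m].
    The meet of two random members contains it with probability about p^2, where
    p = k / (k + m).  For balanced p this is near 1/4; once p >= 2/3 it may be
    near 1/2, and there the parameter 1/2, of cross-entropy ln 2, is safe. *)
Definition weight (k m : nat) : K := if (2 * m <= k)%N then 2^-1 else 4^-1.

Lemma weight_itv k m : 0 < weight k m < 1.
Proof. by rewrite /weight; case: ifP => _; apply/andP; split; lra. Qed.

Lemma ln_weight k m :
  ln (weight k m) = - (if (2 * m <= k)%N then ln 2 else 2 * ln 2).
Proof.
rewrite /weight; case: ifP => _; rewrite lnV ?posrE ?ltr0n //.
by rewrite (_ : 4 = 2 ^+ 2) ?lnXn ?mulr_natl // -natrX.
Qed.

Lemma ln_weightN k m :
  ln (1 - weight k m) = - (if (2 * m <= k)%N then ln 2 else 2 * ln 2 - ln 3).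
Proof.
rewrite /weight; case: ifP => _.
  by rewrite (_ : 1 - 2^-1 = 2^-1) ?lnV ?posrE ?ltr0n //; field.
rewrite (_ : 1 - 4^-1 = 3 / 2 ^+ 2); last by field.
by rewrite ln_div ?posrE ?exprn_gt0 ?ltr0n // lnXn ?ltr0n // opprB mulr_natl.
Qed.

(** The contribution of one coordinate to [family_entropy_le], for the family of
    meets; exchanging [k] and [m] gives that of the complements of joins. *)
Definition cost (k m : nat) : K :=
  - ('C(k, 2)%:R * ln (weight k m)
     + ('C(k + m, 2)%:R - 'C(k, 2)%:R) * ln (1 - weight k m)).

(** Put X = 'C(k, 2), Y = 'C(m, 2), P = 'C(k + m, 2), and k <= m by symmetry.
    If 2k <= m, the joins cost P ln 2 and X <= P / 9, for a total of at most
    P (3 ln 2 - 8/9 ln 3), about 1.59 P ln 2.  Otherwise both parameters are 1/4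
    and X + Y <= 5/9 P, for a total of at most P (4 ln 2 - 13/9 ln 3), about
    1.71 P ln 2.  Replacing ln 3 by 11/7 ln 2 keeps both below 1.7568. *)
Lemma cost_le k m :
  cost k m + cost m k <= 'C(k + m, 2)%:R * (17568 / 10 ^+ 4 * ln 2).
Proof.
wlog: k m / (k <= m)%N.
  by move=> H; case: (leqP k m) => [|/ltnW] /H //; rewrite addrC (addnC m).
have [->|m_gt0 km] := posnP m.
  by rewrite leqn0 => /eqP ->; rewrite /cost addn0 bin0n /= subrr !mul0r !addr0 oppr0 addr0.
rewrite /cost (addnC m) !ln_weight !ln_weightN.
have l2 := ln2_gt0; have l3 := ln2_ln3.
move: (ln 2) (ln 3) l2 l3 => a b a0 ab.
have [k2m|k2m] := leqP (2 * k) m.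
  have -> : (2 * m <= k)%N = false by lia.
  have X9 : 9 * 'C(k, 2)%:R <= 'C(k + m, 2)%:R :> K.
    rewrite !natr_bin2 natrD.
    have h1 : 2 * k%:R <= m%:R :> K by rewrite -natrM ler_nat.
    have h2 : 1 <= m%:R :> K by rewrite ler1n.
    have h3 : 0 <= k%:R :> K by rewrite ler0n.
    have h4 : 0 <= (m%:R - 2 * k%:R) * (m%:R + 4 * k%:R - 1) :> K.
      by apply: mulr_ge0; lra.
    lra.
  have P0 : 0 <= 'C(k + m, 2)%:R :> K by rewrite ler0n.
  move: X9 P0; move: ('C(k, 2)%:R : K) ('C(k + m, 2)%:R : K) => X P X9 P0.
  have Pa := mulr_ge0 P0 (ltW a0).
  have Pb : 0 <= P * (7 * b - 11 * a) by rewrite mulr_ge0 // subr_ge0.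
  have Xb : 0 <= (P - 9 * X) * b by rewrite mulr_ge0 ?subr_ge0 //; lra.
  lra.
have -> : (2 * m <= k)%N = false by lia.
have XY : 9 * ('C(k, 2)%:R + 'C(m, 2)%:R) <= 5 * 'C(k + m, 2)%:R :> K.
  rewrite !natr_bin2 natrD.
  have h1 : m%:R <= 2 * k%:R :> K by rewrite -natrM ler_nat ltnW.
  have h2 : k%:R <= m%:R :> K by rewrite ler_nat.
  have h3 : 0 <= k%:R :> K by rewrite ler0n.
  have h4 : 0 <= (2 * k%:R - m%:R) * (2 * m%:R - k%:R) :> K.
    by apply: mulr_ge0; lra.
  lra.
have P0 : 0 <= 'C(k + m, 2)%:R :> K by rewrite ler0n.
move: XY P0; move: ('C(k, 2)%:R : K) ('C(m, 2)%:R : K) ('C(k + m, 2)%:R : K).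
move=> X Y P XY P0.
have Pa := mulr_ge0 P0 (ltW a0).
have Pb : 0 <= P * (7 * b - 11 * a) by rewrite mulr_ge0 // subr_ge0.
have XYb : 0 <= (5 * P - 9 * (X + Y)) * b by rewrite mulr_ge0 ?subr_ge0 //; lra.
lra.
Qed.

End Cost.

(** * Recovering sets of the Boolean lattice *)

(** Joins are complemented so that, as for meets, a coordinate is in the image
    of a pair exactly when both members lie in a fixed subset of R: the members
    that contain it for meets, those that miss it for joins.  One entropy bound
    then serves both families, with the roles of the two subsets exchanged. *)
Lemma recovering_bin2_le (K : realType) (n : nat) (R : {set {set 'I_n}}) :
    recovering R -> (3 < #|R|)%N ->
  2 * ln 'C(#|R|, 2)%:R <= n%:R * (17568 / 10 ^+ 4 * ln 2) :> K.
Proof.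
move=> recR R3.
pose meet (e : {set {set 'I_n}}) := \bigcap_(A in e) A.
pose cojoin (e : {set {set 'I_n}}) := ~: \bigcup_(A in e) A.
have meet2 A B : A != B -> meet [set A; B] = A :&: B.
  by move=> AB; rewrite /meet big_setU1 ?inE // big_set1.
have cojoin2 A B : A != B -> cojoin [set A; B] = ~: (A :|: B).
  by move=> AB; rewrite /cojoin big_setU1 ?inE // big_set1.
have meet_inj : {in pairs R &, injective meet}.
  apply: pairs_inj => // a b c d aR bR cR dR abcd.
  have [/[!meet_setE] ? _ ? _] := recR a b c d aR bR cR dR abcd.
  move: abcd => /=; rewrite !inE !negb_or.
  by move=> /andP[/and3P[ab ac _] /andP[_ /andP[cd _]]]; rewrite !meet2.
have cojoin_inj : {in pairs R &, injective cojoin}.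
  apply: pairs_inj => // a b c d aR bR cR dR abcd.
  have [_ /[!join_setE] ? _ ?] := recR a b c d aR bR cR dR abcd.
  move: abcd => /=; rewrite !inE !negb_or.
  move=> /andP[/and3P[ab ac _] /andP[_ /andP[cd _]]]; rewrite !cojoin2 //.
  by split=> /setC_inj.
pose Rin i := [set A in R | i \in A].
pose Rout i := [set A in R | i \notin A].
have card_R i : (#|Rin i| + #|Rout i| = #|R|)%N.
  rewrite -(cardsID [set A : {set 'I_n} | i \in A] R); congr (_ + _)%N.
    by apply: eq_card => A; rewrite !inE.
  by apply: eq_card => A; rewrite !inE andbC.
have meetP i : {in pairs R, forall e, (i \in meet e) = (e \subset Rin i)}.
  move=> e /[!inE] /andP[eR _]; apply/bigcapP/subsetP => [H A Ae | H A /H].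
    by rewrite inE (subsetP eR) ?H.
  by rewrite inE => /andP[].
have cojoinP i : {in pairs R, forall e, (i \in cojoin e) = (e \subset Rout i)}.
  rewrite /cojoin => e /[!inE] /andP[eR _]; apply/negP/subsetP.
    move=> H A Ae; rewrite inE (subsetP eR) //; apply/negP => iA.
    by apply: H; apply/bigcupP; exists A.
  by move=> H /bigcupP[A /H]; rewrite inE => /andP[_ /negPf->].
have Rin_sub i : Rin i \subset R by apply/subsetP=> A; rewrite inE => /andP[].
have Rout_sub i : Rout i \subset R by apply/subsetP=> A; rewrite inE => /andP[].
have := family_entropy_le (meet @: pairs R)
  (fun i => weight_itv K #|Rin i| #|Rout i|).
have := family_entropy_le (cojoin @: pairs R)
  (fun i => weight_itv K #|Rout i| #|Rin i|).
rewrite !card_in_imset // !card_pairs.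
set P : K := 'C(#|R|, 2)%:R => Hcojoin Hmeet.
have P0 : 0 < P by rewrite ltr0n bin_gt0 (leq_trans _ R3).
rewrite -(ler_pM2l P0) [leLHS]mulrCA [leLHS]mulr_natl mulr2n.
apply: le_trans (lerD Hmeet Hcojoin) _; rewrite -big_split /=.
rewrite [leRHS]mulrCA [leRHS]mulr_natl -[n in leRHS]card_ord -sumr_const.
apply: (@ler_sum K _ _ (fun=> true)) => i _.
rewrite (card_pairs_image meet_inj (Rin_sub i) (meetP i)).
rewrite (card_pairs_image cojoin_inj (Rout_sub i) (cojoinP i)).
have := cost_le K #|Rin i| #|Rout i|.
by rewrite /cost [(#|Rout i| + _)%N]addnC card_R.
Qed.

Theorem theorem3p1 (K : realType) (n : nat) (n_gt0 : (0 < n)%N)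
    (R : {set {set 'I_n}}) (recR : recovering R) :
  #|R|%:R <= Num.sqrt 3 * 2 `^ (4392 / 10 ^+ 4 * n%:R) :> K.
Proof.
have l2 := ln2_gt0 K; have l3 := ln2_ln3 K; have l3' := ln3_ln2 K.
have [->|R0] := eqVneq R set0.
  by rewrite cards0 mulr_ge0 ?sqrtr_ge0 ?powR_ge0.
have N0 : 0 < #|R|%:R :> K by rewrite ltr0n card_gt0.
have s0 : 0 < Num.sqrt 3 :> K by rewrite sqrtr_gt0 ltr0n.
have p0 : 0 < 2 `^ (4392 / 10 ^+ 4 * n%:R) :> K by exact: powR_gt0.
rewrite -ler_ln ?posrE ?mulr_gt0 // lnM ?posrE // ln_powR.
have -> : ln (Num.sqrt 3) = ln 3 / 2 :> K.
  by rewrite -[in RHS](@sqr_sqrtr K 3) ?ler0n // lnXn // -[ln _ *+ _]mulr_natr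
    mulfK ?pnatr_eq0.
have n1 : ln 2 <= n%:R * ln 2 :> K by rewrite ler_peMl ?ler1n // ltW.
case: (ltnP 3 #|R|) => R3.
  have P0 : 0 < 'C(#|R|, 2)%:R :> K by rewrite ltr0n bin_gt0 (leq_trans _ R3).
  (* 3 'C(N, 2) - N ^ 2 = N (N - 3) / 2. *)
  have : #|R|%:R ^+ 2 <= 3 * 'C(#|R|, 2)%:R :> K.
    rewrite natr_bin2; have h : 3 <= #|R|%:R :> K by rewrite ler_nat ltnW.
    have : 0 <= #|R|%:R * (#|R|%:R - 3) :> K by rewrite mulr_ge0 ?subr_ge0 // ltW.
    lra.
  move=> sq_le; have : ln (#|R|%:R ^+ 2) <= ln (3 * 'C(#|R|, 2)%:R) :> K.
    by rewrite ler_ln // posrE ?exprn_gt0 // mulr_gt0 // ltr0n.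
  rewrite lnXn // lnM ?posrE //.
  have := recovering_bin2_le K recR R3.
  lra.
have small : (#|R| <= 2)%N -> ln #|R|%:R <= ln 2 :> K.
  by move=> R2; rewrite ler_ln ?posrE // ler_nat.
case: (leqP #|R| 2) => R2; first by have := small R2; lra.
(* Three points do not fit into B_1, so here n >= 2. *)
have n2 : 2 * ln 2 <= n%:R * ln 2 :> K.
  rewrite ler_pM2r // ler_nat.
  have := leq_trans R2 (max_card (mem R)).
  by rewrite -cardsT -powersetT card_powerset cardsT card_ord;
    case: (n) n_gt0 => [|[|]].
have -> : #|R| = 3 by apply/eqP; rewrite eqn_leq R3 R2.
lra.
Qed.
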